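(* Let $\alpha\in(-1,1)$, $a>-1$, $M_1,M_2\in\mathbb{N}$. Let $(t_j,w^{(t)}_j)_{j=1}^{M_1}$ be the $M_1$-point Gauss quadrature nodes and weights on $[\alpha,1]$ with weight $(t-\alpha)^a$, and let $(s_l,w^{(s)}_l)_{l=1}^{M_2}$ be the $M_2$-point Gauss quadrature nodes and weights on $[-1,1]$ with weight $(1-x^2)^{-1/2}$. For $j=1,\dots,M_1$ and $l=1,\dots,M_2$ define \begin{align*} (x_{l+(j-1)M_2},\,y_{l+(j-1)M_2})&:=\rho(t_j)\,\big(s_l,\sqrt{1-s_l^2}\big),\\ z_{l+(j-1)M_2}&:=t_j,\\ w_{l+(j-1)M_2}&:=w^{(t)}_j\,w^{(s)}_l, \end{align*} and let $M=M_1M_2$. For a function $f$ on $\Omega$ consider the quadrature rule $$\int_\Omega f(x,y,z)\,(z-\alpha)^a\,dA\;\approx\;\sum_{j=1}^{M}w_j\big[f(x_j,y_j,z_j)+f(-x_j,-y_j,z_j)\big].$$ Let $N\in\mathbb{N}$. If $M_1\ge\frac12(N+1)$ and $M_2\ge N+1$, then this quadrature rule is exact (the two sides are equal) whenever $f$ is a polynomial in $x,y,z$ of degree $\le N$.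
   Context: $\Omega=\{(x,y,z)\in\mathbb{R}^3:\alpha<z<1,\ x^2+y^2+z^2=1\}$ is the spherical cap, $\rho(z)=\sqrt{1-z^2}$, and $dA$ is the uniform surface measure on the unit sphere, so that $$\int_\Omega f\,(z-\alpha)^a\,dA=\int_\alpha^1\int_0^{2\pi}f(\rho(z)\cos\theta,\rho(z)\sin\theta,z)\,d\theta\,(z-\alpha)^a\,dz.$$ *)

(* Defs.v *)
From HB Require Import structures.
From mathcomp Require Import all_boot all_order all_algebra.
(* The notations of mpoly clash with those of analysis, and its module Measure
   would shadow the one of analysis if imported later. *)
From mathcomp.multinomials Require Import -(notations) mpoly.
From mathcomp Require Import all_classical all_reals all_analysis.
From mathcomp Require Import measurable_realfun ring lra.

Set Implicit Arguments.
Unset Strict Implicit.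
Unset Printing Implicit Defensive.

Import Order.TTheory GRing.Theory Num.Theory.
Import numFieldNormedType.Exports.

Local Open Scope classical_set_scope.
Local Open Scope ring_scope.

Section gauss_quadrature.
Context {R : realType}.
Implicit Types (b c : R) (omega : R -> R).

Definition orthogonal_poly b c omega (n : nat) (P : {poly R}) : Prop :=
  size P = n.+1 /\
  forall q : {poly R}, (size q <= n)%N ->
    (\int[lebesgue_measure]_(x in `[b, c]) (P.[x] * q.[x] * omega x)%:E = 0)%E.

Definition lagrange_poly (n : nat) (x : 'I_n -> R) (j : 'I_n) : {poly R} :=
  \prod_(k < n | k != j) ((x j - x k)^-1 *: ('X - (x k)%:P)).

(* The nodes are the zeros of the orthogonal polynomial of degree n (all of
   them: there are n, pairwise distinct) and the weights are those of the
   interpolatory rule.  The order of the nodes is left free. *)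
Definition gauss_quadrature b c omega (n : nat) (x w : 'I_n -> R) : Prop :=
  [/\ injective x,
      exists2 P : {poly R}, orthogonal_poly b c omega n P
                          & forall j, root P (x j)
    & forall j, ((w j)%:E =
        \int[lebesgue_measure]_(t in `[b, c])
          ((lagrange_poly x j).[t] * omega t)%:E)%E].

End gauss_quadrature.

Fact node_index_subproof (m n : nat) (j : 'I_m) (l : 'I_n) :
  (l + j * n < m * n)%N.
Proof.
apply: (@leq_trans (j.+1 * n)); first by rewrite mulSn ltn_add2r.
by rewrite leq_mul2r ltn_ord orbT.
Qed.

(* Zero-based version of (j, l) |-> l + (j - 1) n. *)
Definition node_index (m n : nat) (j : 'I_m) (l : 'I_n) : 'I_(m * n) :=
  Ordinal (node_index_subproof j l).

Section spherical_cap.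
Context {R : realType}.

Definition rho (z : R) : R := Num.sqrt (1 - z ^+ 2).

Definition cap (alpha : R) : set (R * R * R) :=
  [set p | alpha < p.2 < 1 /\ p.1.1 ^+ 2 + p.1.2 ^+ 2 + p.2 ^+ 2 = 1].

(* Cylindrical parametrisation of the unit sphere by u = (z, theta).  Its area
   element |d_z x d_theta| is 1, so the surface measure is the image of the
   Lebesgue measure dz dtheta on ]-1, 1[ x [0, 2 pi[. *)
Definition sphere_param (u : measurableTypeR R * measurableTypeR R) :
    measurableTypeR R * measurableTypeR R * measurableTypeR R :=
  (rho u.1 * cos u.2, rho u.1 * sin u.2, u.1).

Definition param_domain : set (measurableTypeR R * measurableTypeR R) :=
  `]-1, 1[ `*` `[0, 2 * pi[.

Lemma measurable_param_domain : measurable param_domain.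
Proof. by apply: measurableX; exact: measurable_itv. Qed.

Lemma measurable_sphere_param : measurable_fun setT sphere_param.
Proof.
have mrho : measurable_fun setT
    (fun u : measurableTypeR R * measurableTypeR R => rho u.1).
  apply: (measurableT_comp (f := @Num.sqrt R)).
    exact: continuous_measurable_fun (@sqrt_continuous R).
  apply: measurable_funB => //.
  by apply: measurable_funX; exact: measurable_fst.
apply: measurable_fun_pair; last exact: measurable_fst.
apply: measurable_fun_pair.
- apply: measurable_funM => //.
  apply: (measurableT_comp (f := @cos R)); last exact: measurable_snd.
  exact: continuous_measurable_fun (@continuous_cos R).
- apply: measurable_funM => //.
  apply: (measurableT_comp (f := @sin R)); last exact: measurable_snd.
  exact: continuous_measurable_fun (@continuous_sin R).
Qed.

Definition surface_measure :
    set (measurableTypeR R * measurableTypeR R * measurableTypeR R) -> \bar R :=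
  pushforward
    (mrestr (lebesgue_measure \x lebesgue_measure)%E measurable_param_domain)
    sphere_param.

Let surface_measure0 : surface_measure set0 = 0%E.
Proof. by rewrite /surface_measure /pushforward preimage_set0 measure0. Qed.

Let measurable_preimage_param
    (A : set (measurableTypeR R * measurableTypeR R * measurableTypeR R)) :
  measurable A -> measurable (sphere_param @^-1` A).
Proof.
by move=> mA; rewrite -[X in measurable X]setTI; exact: measurable_sphere_param.
Qed.

Let surface_measure_ge0 A : (0 <= surface_measure A)%E.
Proof. by rewrite /surface_measure /pushforward; exact: measure_ge0. Qed.

Let surface_measure_sigma_additive : semi_sigma_additive surface_measure.
Proof.
move=> F mF tF mUF; rewrite /surface_measure /pushforward preimage_bigcup.
apply: measure_semi_sigma_additive.
- by move=> n; exact: measurable_preimage_param.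
- apply/trivIsetP => /= i j _ _ ij; rewrite -preimage_setI.
  by move/trivIsetP : tF => /(_ _ _ _ _ ij) ->//; rewrite preimage_set0.
- by rewrite -preimage_bigcup; exact: measurable_preimage_param.
Qed.

HB.instance Definition _ := isMeasure.Build _ _ _ surface_measure
  surface_measure0 surface_measure_ge0 surface_measure_sigma_additive.

(* mmeasure mdeg p is the total degree of p plus one (0 if p = 0). *)
Definition polynomial_on (D : set (R * R * R)) (N : nat) (f : R * R * R -> R) :
    Prop :=
  exists2 p : mpoly 3 R, (mmeasure (@mdeg 3) p <= N.+1)%N
  & forall x y z : R, D (x, y, z) ->
      f (x, y, z) = meval (tnth [tuple x; y; z]) p.

End spherical_cap.

Lemma measurable_cap (R : realType) (alpha : R) :
  measurable (cap alpha : set (measurableTypeR R * measurableTypeR R * measurableTypeR R)).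
Proof.
set T := (measurableTypeR R * measurableTypeR R * measurableTypeR R)%type.
have -> : cap alpha = ((fun p : T => p.2) @^-1` `]alpha, 1[) `&`
  ((fun p : T => p.1.1 ^+ 2 + p.1.2 ^+ 2 + p.2 ^+ 2) @^-1` [set 1]).
  by apply/seteqP; split => p /=; rewrite in_itv.
apply: measurableI.
  rewrite -[X in measurable X]setTI; apply: measurable_snd => //.
rewrite -[X in measurable X]setTI.
have mf : measurable_fun setT (fun p : T => p.1.1 ^+ 2 + p.1.2 ^+ 2 + p.2 ^+ 2 : R).
  apply: measurable_funD; first apply: measurable_funD.
  - apply: measurable_funX. apply: (measurableT_comp (f := fst)); exact: measurable_fst.
  - apply: measurable_funX. apply: (measurableT_comp (f := snd)); [exact: measurable_snd|exact: measurable_fst].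
  - apply: measurable_funX. exact: measurable_snd.
by apply: mf.
Qed.

(* Archimedes' formula: on the cap, dA is dtheta dz. *)
Lemma ge0_integral_cap (R : realType) (alpha : R) (g : R * R * R -> \bar R) :
  -1 < alpha ->
  measurable_fun [set: measurableTypeR R * measurableTypeR R * measurableTypeR R] g ->
  (forall p, 0 <= g p)%E ->
  (\int[surface_measure]_(p in cap alpha) g p =
   \int[lebesgue_measure]_(z in `]alpha, 1%R[)
     \int[lebesgue_measure]_(th in `[0%R, (2 * pi)%R[)
       g (rho z * cos th, rho z * sin th, z)%R)%E.
Proof.
move=> a1 mg g0.
set T := (measurableTypeR R * measurableTypeR R)%type.
rewrite (ge0_integral_pushforward (@measurable_sphere_param R)); last 3 first.
- exact: measurable_cap.
- exact: measurable_funTS.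
- by move=> *; exact: g0.
set D := param_domain.
set E := sphere_param @^-1` cap alpha.
have mE : measurable E.
  by rewrite -[X in measurable X]setTI; apply: measurable_sphere_param => //; exact: measurable_cap.
have mD : measurable D by exact: measurable_param_domain.
have mgs : measurable_fun setT (g \o sphere_param : T -> _).
  by apply: measurableT_comp => //; exact: measurable_sphere_param.
rewrite -(setUIDK E D) ge0_integral_setU//; last 5 first.
- exact: measurableI.
- exact: measurableD.
- exact: measurable_funTS.
- by move=> x _; exact: g0.
- by apply/disj_setPS => x [[_ ?] [_ ?]].
rewrite [X in (_ + X)%E]null_set_integral ?adde0; last 3 first.
- exact: measurableD.
- exact: measurable_funTS.
- by rewrite /= /mrestr setDE -setIA setICl setI0 measure0.
rewrite (@eq_measure_integral _ _ _ _ (lebesgue_measure \x lebesgue_measure)%E); last first.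
  by move=> A mA AED; rewrite /= /mrestr setIidl// => x /AED [].
have -> : E `&` D = `]alpha, 1[ `*` `[0, 2 * pi[.
  apply/seteqP; split=> -[z th] /=.
    by rewrite /E/D/=/cap/= => -[[? _] [_ ?]]; rewrite in_itv.
  rewrite /E/D/=/param_domain/=/cap/= !in_itv /= => -[/andP[az z1] th0].
  have z1' : -1 < z < 1 by rewrite z1 (lt_trans a1 az).
  split; last by [].
  rewrite az z1; split => //.
  rewrite !exprMn -mulrDr cos2Dsin2 mulr1 /rho sqr_sqrtr ?subrK//.
  by case/andP: z1' => ? ?; nra.
rewrite integral_mkcond fubini_tonelli1; last 2 first.
- apply/(measurable_restrictT _ _).1 => //; last exact: measurable_funTS.
  by apply: measurableX; exact: measurable_itv.
- by move=> x; rewrite patchE; case: ifP => //= _; exact: g0.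
rewrite [RHS]integral_mkcond; apply: eq_integral => z _.
rewrite /fubini_F patchE; case: ifPn => hz.
  rewrite [RHS]integral_mkcond; apply: eq_integral => th _.
  rewrite !patchE in_setX hz /=. by [].
rewrite integral0_eq// => th _; rewrite patchE in_setX (negbTE hz) //.
Qed.

(* Main.v *)
Require Import Defs.
From mathcomp Require Import all_boot all_order all_algebra.
From mathcomp.multinomials Require Import -(notations) mpoly.
From mathcomp Require Import all_classical all_reals all_analysis.
From mathcomp Require Import measurable_realfun ring lra zify.

Set Implicit Arguments.
Unset Strict Implicit.
Unset Printing Implicit Defensive.

Import Order.TTheory GRing.Theory Num.Theory.
Import numFieldNormedType.Exports.

Local Open Scope classical_set_scope.
Local Open Scope ring_scope.

(* In cylindrical coordinates the integral of the monomial x^i y^j z^k over the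
   cap splits as the integral of rho(z)^(i+j) z^k (z - alpha)^a over z times
   the trigonometric moment, the integral over a period of
   cos(th)^i sin(th)^j.  The moment vanishes unless i and j are both even; then
   rho^(i+j) z^k is a polynomial of degree at most N < 2 M1, integrated exactly
   by the first rule, and cos^i sin^j is a polynomial in cos(th), so that
   t = cos(th) turns the moment into a Chebyshev-weighted integral that the
   second rule integrates exactly.  In the other cases the discrete angular sum
   must also vanish: by the pairing of (x, y) with (-x, -y) if i + j is odd,
   and by the symmetry s -> -s of the Gauss-Chebyshev rule if i and j are both
   odd.  The Gauss nodes lie in the open intervals, hence the quadrature points
   on the cap, where f agrees with its polynomial. *)

(** * Integrals with endpoint singularities: integrability of the two weights and the substitution t
    = cos(th) *)

Section improper_integrals.
Context {R : realType}.
Notation mu := (@lebesgue_measure R).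
Implicit Types q : {poly R}.

(** The usual theorem holds on compact subintervals exhausting []a, b[]; monotone convergence passes
    to the limit. Nonnegativity takes the place of integrability, so [f] may blow up at both
    endpoints, as the Gauss weights can. *)
Lemma ge0_continuous_FTC2_oo (f F : R -> R) (a b : R) : a < b ->
  {in `]a, b[, forall x : R, 0 <= f x} ->
  {in `]a, b[, continuous f} ->
  {in `]a, b[, forall x : R, is_derive x 1 F (f x)} ->
  F x @[x --> a^'+] --> F a -> F x @[x --> b^'-] --> F b ->
  (\int[mu]_(x in `[a, b]) (f x)%:E = (F b)%:E - (F a)%:E)%E.
Proof.
move=> ab f0 cf dF Fa Fb.
have mf : measurable_fun `]a, b[ f.
  apply: open_continuous_measurable_fun => //.
  by move=> x; rewrite inE/= => xab; exact: cf.
rewrite (@integral_itv_bndoo _ a b _ true false); last exact/measurable_EFinP.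
(* Denominators start at 3 so that already for n = 0 the interval from a + e n to b - e n is
   nondegenerate. *)
pose e (n : nat) : R := (b - a) / n.+3%:R.
have e0 n : 0 < e n by rewrite divr_gt0// subr_gt0.
have e_cvg : e n @[n --> \oo] --> (0 : R).
  rewrite -[X in _ --> X](mulr0 (b - a)); apply: cvgMr.
  have := @cvg_harmonic R; rewrite -(cvg_shiftn 2).
  by under eq_fun do rewrite addn2.
have eab n : a + e n < b - e n.
  suff : e n * 2 < b - a by lra.
  by rewrite mulrAC ltr_pdivrMr// ltr_pM2l ?subr_gt0// ltr_nat.
pose S n := `[a + e n, b - e n]%classic.
have e_ni m n : (m <= n)%N -> e n <= e m.
  move=> mn; rewrite ler_pM2l ?subr_gt0// lef_pV2 ?posrE//.
  by rewrite ler_nat !ltnS.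
have ndS : nondecreasing_seq S.
  move=> m n mn; apply/subsetPset; apply: subset_itv; rewrite bnd_simp.
    by rewrite lerD2l e_ni.
  by rewrite lerD2l lerN2 e_ni.
have Sab n : S n `<=` `]a, b[.
  apply: subset_itv; rewrite bnd_simp; first by rewrite ltrDl.
  by rewrite gtrDl oppr_lt0.
have US : `]a, b[%classic = \bigcup_n S n.
  apply/seteqP; split; last by move=> x [n _]; exact: Sab.
  move=> x /=; rewrite in_itv/= => /andP[ax xb].
  have : \forall n \near \oo, e n < Num.min (x - a) (b - x).
    move/cvgrPdist_lt : e_cvg => /(_ (Num.min (x - a) (b - x))).
    rewrite lt_min !subr_gt0 ax xb => /(_ erefl); apply: filterS => n.
    by rewrite sub0r normrN gtr0_norm.
  move=> [n _ /(_ n (leqnn n))]/=; rewrite lt_min => /andP[eax exb].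
  exists n => //; rewrite /S/= in_itv/=; apply/andP; split; lra.
(* The integrals over [S n] converge to the one over []a, b[]; it remains to find their limit
   through [F]. *)
have := @ge0_nondecreasing_set_cvg_integral _ (measurableTypeR R) R S
  (EFin \o f) mu ndS.
rewrite -US => /(_ (fun n => measurable_itv _)) intS_cvg.
apply: (cvg_unique _ (intS_cvg _ _)) => //.
- by move=> n; apply/measurable_EFinP; exact: measurable_funS (Sab n) mf.
- by move=> n x /Sab xab; rewrite lee_fin f0.
have cF x : x \in `]a, b[ -> {for x, continuous F}.
  move=> /dF[dFx _].
  exact/differentiable_continuous/derivable1_diffP.
have intS n : (\int[mu]_(x in S n) (f x)%:E = (F (b - e n) - F (a + e n))%:E)%E.
  rewrite EFinB; apply: continuous_FTC2 => //.
  - by apply: continuous_in_subspaceT => x; rewrite inE => /Sab; exact: cf.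
  - split.
    + by move=> x /subset_itv_oo_cc /Sab /dF[].
    + apply: cvg_at_right_filter; apply: cF; apply: (Sab n).
      by rewrite /S/= in_itv/= lexx (ltW (eab n)).
    + apply: cvg_at_left_filter; apply: cF; apply: (Sab n).
      by rewrite /S/= in_itv/= lexx (ltW (eab n)).
  - by move=> x /subset_itv_oo_cc /Sab /dF ?; rewrite derive1E derive_val.
rewrite (_ : (fun n => _) = EFin \o (fun n => F (b - e n) - F (a + e n))); last first.
  exact/funext.
rewrite -EFinB; apply: cvg_EFin; first exact: nearW.
apply: cvgB.
- move/cvg_at_leftP : Fb; apply; split; first by move=> n; rewrite gtrDl oppr_lt0.
  by rewrite -[X in _ --> X]subr0; apply: cvgB => //; exact: cvg_cst.
- move/cvg_at_rightP : Fa; apply; split; first by move=> n; rewrite ltrDl.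
  by rewrite -[X in _ --> X]addr0; apply: cvgD => //; exact: cvg_cst.
Qed.

(** The antiderivative (x - b)^(a + 1) / (a + 1) is continuous up to b because a + 1 > 0, so the
    integral is a finite difference of its values. *)
Lemma integrable_powR_subl (b c a : R) : b < c -> -1 < a ->
  mu.-integrable `[b, c] (EFin \o (fun r => (r - b) `^ a)).
Proof.
move=> bc a1.
have mw : measurable_fun `[b, c] (fun r : R => (r - b) `^ a).
  apply: (@measurableT_comp _ _ _ _ _ _ (@powR R ^~ a)) => //.
  exact: measurable_funB.
apply/integrableP; split; first exact/measurable_EFinP.
under eq_integral do rewrite /= ger0_norm ?powR_ge0//.
have dpow (x r : R) : b < x ->
    is_derive x 1 (fun y => (y - b) `^ r) (r * (x - b) `^ (r - 1)).
  move=> bx; have xb0 : 0 < x - b by rewrite subr_gt0.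
  have := @is_derive1_comp _ (@powR R ^~ r) (fun y => y - b) x _ 1
    (is_derive1_powR _ xb0); rewrite mulr1; apply.
  by apply: is_derive_eq; rewrite subr0.
have a10 : a + 1 != 0 by apply: lt0r_neq0; lra.
rewrite (@ge0_continuous_FTC2_oo _ (fun x => (a + 1)^-1 * (x - b) `^ (a + 1)))//.
- by rewrite -EFinB ltry.
- by move=> x _; exact: powR_ge0.
- move=> x; rewrite in_itv/= => /andP[bx xc].
  apply: differentiable_continuous; apply/derivable1_diffP.
  by have [] := dpow x a bx.
- move=> x; rewrite in_itv/= => /andP[bx xc].
  have := dpow x (a + 1) bx; rewrite addrK => dF.
  by have := is_deriveZ (a + 1)^-1 dF; rewrite /GRing.scale/= mulrA mulVf ?mul1r.
- apply: cvgMr; rewrite subrr powR0//.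
  have /cvg_at_rightP h := @powR_cvg0 R (a + 1) ltac:(lra).
  apply/cvg_at_rightP => u [ub ucv]; apply: (h (fun n => u n - b)); split.
    by move=> n; rewrite subr_gt0.
  by rewrite -[X in _ --> X](subrr b); apply: cvgB => //; exact: cvg_cst.
- apply: cvgMr; apply: cvg_at_left_filter.
  apply: (differentiable_continuous (f := fun y : R => (y - b) `^ (a + 1))).
  by apply/derivable1_diffP; have [] := dpow c (a + 1) bc.
Qed.

Lemma continuous_horner_comp (q : {poly R}) (g : R -> R) :
  continuous g -> continuous (fun x => q.[g x]).
Proof.
move=> cg x; apply: continuous_comp; first exact: cg.
exact: continuous_horner.
Qed.

(** Inverse of the continuous bijection cos from [0, pi] onto [-1, 1]. It supplies the one-sided
    limits at -1 and 1, where [acos] has no derivative. *)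
Lemma continuous_acos_cc : {within `[-1, 1], continuous (@acos R)}.
Proof.
rewrite -[X in `[_, X]](@cos0 R) -cospi; apply: segment_can_ge_continuous.
- exact: pi_ge0.
- by apply: continuous_in_subspaceT => x _; exact: continuous_cos.
- exact: cosK.
Qed.

Lemma chebyshev_weightE (r : R) : -1 < r < 1 ->
  (1 - r ^+ 2) `^ (- (1 / 2)) = (Num.sqrt (1 - r ^+ 2))^-1.
Proof.
by move=> /andP[r1 r2]; rewrite powRN mul1r powR12_sqrt//; nra.
Qed.

(* The upper and lower half circles give the two terms of the antiderivative
   Phi (2 pi - acos t) - Phi (acos t). *)
Lemma ge0_integral_chebyshev (q : {poly R}) :
  {in `]-1, 1[, forall x : R, 0 <= q.[x]} ->
  (\int[mu]_(r in `[(-1)%R, 1%R]) (q.[r] * (1 - r ^+ 2) `^ (- (1 / 2)))%:E =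
   (2^-1 * (\int[mu]_(th in `[0%R, (2 * pi)%R]) q.[cos th])%R)%:E)%E.
Proof.
move=> q0; have pi0 := @pi_gt0 R.
pose h (x : R) := q.[cos x].
have ch : continuous h by apply: continuous_horner_comp; exact: continuous_cos.
(* Starting at -1 and stopping at 2 pi + 1 leaves a margin around [0, 2 pi], so that [Phi] is
   differentiable at 0 and 2 pi too. *)
pose Phi (x : R) := \int[mu]_(u in `[-1, x]) h u.
have ih u v : mu.-integrable `[u, v] (EFin \o h).
  apply: continuous_compact_integrable; first exact: segment_compact.
  exact: continuous_subspaceT.
have dPhi (x : R) : -1 < x < 2 * pi + 1 -> is_derive x 1 Phi (h x).
  move=> /andP[x1 x2].
  have [dP PE] := continuous_FTC1_closed x2 (ih _ _) x1 (ch x).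
  by rewrite -PE derive1E; exact/derivableP.
have cPhi (x : R) : -1 < x < 2 * pi + 1 -> {for x, continuous Phi}.
  move=> /dPhi[dP _].
  exact/differentiable_continuous/derivable1_diffP.
pose F (r : R) := 2^-1 * (Phi (2 * pi - acos r) - Phi (acos r)).
have ac (r : R) : -1 <= r <= 1 -> 0 <= acos r <= pi.
  by move=> r1; rewrite acos_ge0// acos_lepi.
have [cac ac1 ac2] : [/\ {in `]-1, 1[, continuous (@acos R)},
    acos x @[x --> (-1 : R)^'+] --> acos (-1 : R) &
    acos x @[x --> (1 : R)^'-] --> acos (1 : R)].
  have n11 : -1 < 1 :> R by lra.
  by apply/(continuous_within_itvP _ n11); exact: continuous_acos_cc.
have cF (G : set_system R) : Filter G -> forall l : R, -1 <= l <= 1 ->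
    acos x @[x --> G] --> acos l -> F x @[x --> G] --> F l.
  move=> FG l /ac/andP[l0 lpi] acl; apply: cvgMr; apply: cvgB.
    apply: (@cvg_comp _ _ _ _ Phi _ (nbhs (2 * pi - acos l))).
      by apply: cvgB => //; exact: cvg_cst.
    by apply: cPhi; apply/andP; split; lra.
  apply: (@cvg_comp _ _ _ _ Phi _ (nbhs (acos l))) => //.
  by apply: cPhi; apply/andP; split; lra.
rewrite (@ge0_continuous_FTC2_oo _ F).
- rewrite -EFinB /F acosN1 acos1 subr0 (_ : 2 * pi - pi = pi); last by ring.
  rewrite subrr mulr0 subr0 Rintegral_itvB ?bnd_simp//; [|lra..].
  rewrite Rintegral_itv_obnd_cbnd//.
  by apply: integrableS (ih 0 (2 * pi)) => //; exact: subset_itv_oc_cc.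
- lra.
- by move=> x x1; rewrite mulr_ge0 ?powR_ge0// q0.
- move=> x; rewrite in_itv/= => x11.
  apply: cvgM; first exact: continuous_horner.
  apply: (differentiable_continuous
    (f := fun r : R => (1 - r ^+ 2) `^ (- (1 / 2)))).
  apply/derivable1_diffP.
  apply: (@ex_derive _ _ _ _ _ _
    ((- (1 / 2)) * (1 - x ^+ 2) `^ (- (1 / 2) - 1) * - (2 * x))).
  apply: (@is_derive1_comp _ (@powR R ^~ (- (1 / 2))) (fun r => 1 - r ^+ 2)).
    by apply: is_derive1_powR; nra.
  apply: is_derive_eq.
  by rewrite /GRing.scale/= !mulr1 add0r mul1r mulr2n mulrDl mul1r.
- move=> x; rewrite in_itv/= => /[dup] x11 /andP[x1 x2].
  have /andP[a0 api] : 0 <= acos x <= pi by apply: ac; rewrite !ltW.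
  have da := is_derive1_acos x11.
  have d1 : is_derive x 1 (Phi \o @acos R)
      (h (acos x) * - (Num.sqrt (1 - x ^+ 2))^-1).
    by apply: is_derive1_comp; apply: dPhi; lra.
  have d2 : is_derive x 1 (Phi \o (fun r => 2 * pi - acos r))
      (h (2 * pi - acos x) * (0 - - (Num.sqrt (1 - x ^+ 2))^-1)).
    by apply: is_derive1_comp; apply: dPhi; lra.
  have dF : is_derive x 1 F _ := is_deriveZ 2^-1 (is_deriveB d2 d1).
  apply: (is_derive_eq dF).
  (* Since cos(2 pi - acos x) = cos(acos x) = x, the two terms are equal and the factor 1/2 leaves
     one of them. *)
  rewrite chebyshev_weightE// /h /GRing.scale/= [2 * pi]mulr_natl.
  rewrite cosB cos2pi sin2pi.
  rewrite mul0r addr0 mul1r acosK ?in_itv/= ?ltW//.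
  lra.
- by apply: cF => //; lra.
- by apply: cF => //; lra.
Qed.

End improper_integrals.

(** Each root splits off a linear factor, so induction on the size applies. Finiteness makes the
    zero set Lebesgue-null. *)
Lemma finite_set_root (F : idomainType) (q : {poly F}) :
  q != 0 -> finite_set [set x | root q x].
Proof.
have [n] := ubnP (size q); elim: n q => // n IH q qn qN0.
have [[a qa]|noroot] := pselect (exists a, root q a); last first.
  rewrite (_ : [set x | _] = set0); first exact: finite_set0.
  by apply/seteqP; split => // x qx; apply: noroot; exists x.
have [r qE] := factor_theorem _ _ qa.
have rN0 : r != 0 by apply: contraNneq qN0 => r0; rewrite qE r0 mul0r.
rewrite (_ : [set x | _] = [set x | root r x] `|` [set a]).
  rewrite finite_setU; split; last exact: finite_set1.
  by apply: IH => //; move: qn; rewrite qE size_Mmonic ?monicXsubC// size_XsubC addn2.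
apply/seteqP; split => x /=; rewrite qE rootM root_XsubC.
  by move=> /orP[|/eqP]; [left|right].
by move=> [->//|->]; rewrite eqxx orbT.
Qed.

(** * Gauss quadrature for a general positive integrable weight: location of the nodes, exactness,
    symmetry *)

Section gauss.
Context {R : realType}.
Notation mu := (@lebesgue_measure R).
Variables (b c : R) (omega : R -> R).
Hypothesis bc : b < c.
Hypothesis iomega : mu.-integrable `[b, c] (EFin \o omega).
Hypothesis omega_gt0 : {in `]b, c[, forall x : R, 0 < omega x}.
Implicit Types p q P : {poly R}.

Definition weighted_integral q : R :=
  \int[mu]_(x in `[b, c]) (q.[x] * omega x).
Let L := weighted_integral.

Lemma bounded_horner q : exists M : R, forall x, x \in `[b, c] -> `|q.[x]| <= M.
Proof.
have cq : {within `[b, c], continuous (fun x => `|q.[x]|)}.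
  apply: continuous_subspaceT => x; apply: continuous_comp.
    exact: continuous_horner.
  exact: norm_continuous.
have [x _ Mx] := EVT_max (ltW bc) cq.
by exists `|q.[x]|.
Qed.

Lemma integrable_horner_weight q :
  mu.-integrable `[b, c] (EFin \o (fun x => q.[x] * omega x)).
Proof.
have mq : measurable_fun `[b, c] (horner q).
  apply: measurable_funTS; apply: continuous_measurable_fun.
  exact: continuous_horner.
have [M qM] := bounded_horner q.
rewrite (_ : _ \o _ = ((EFin \o horner q) \* (EFin \o omega))%E); last first.
  by apply/funext => x /=; rewrite EFinM.
apply: integrableMr => //.
exists M; split; first exact: num_real.
by move=> y My x /qM qx; exact: le_trans qx (ltW My).
Qed.

Lemma weighted_integralE q :
  (\int[mu]_(x in `[b, c]) (q.[x] * omega x)%:E = (L q)%:E)%E.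
Proof.
rewrite fineK//; apply: integrable_fin_num => //.
exact: integrable_horner_weight.
Qed.

Lemma weighted_integralD p q : L (p + q) = L p + L q.
Proof.
rewrite -RintegralD//; [|exact: integrable_horner_weight..].
by apply: eq_Rintegral => x _; rewrite hornerD mulrDl.
Qed.

Lemma weighted_integralZ k q : L (k *: q) = k * L q.
Proof.
rewrite -RintegralZl//; last exact: integrable_horner_weight.
by apply: eq_Rintegral => x _; rewrite hornerZ mulrA.
Qed.

Lemma weighted_integral_sum (I : Type) (r : seq I) (Q : pred I)
    (F : I -> {poly R}) :
  L (\sum_(i <- r | Q i) F i) = \sum_(i <- r | Q i) L (F i).
Proof.
apply: (big_morph _ weighted_integralD).
by rewrite -(scale0r 0) weighted_integralZ mul0r.
Qed.

(** A nonnegative integrand with zero integral vanishes almost everywhere. As the weight is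
    positive, the open interval would then be covered by a null set and the finitely many roots of
    [q], against its positive length. *)
Lemma weighted_integral_eq0 q :
  {in `]b, c[, forall x : R, 0 <= q.[x]} -> L q = 0 -> q = 0.
Proof.
move=> q0 Lq0; apply: contrapT => /eqP qN0.
have ioo : mu.-integrable `]b, c[ (EFin \o (fun x => q.[x] * omega x)).
  by apply: integrableS (integrable_horner_weight q) => //; exact: subset_itv_oo_cc.
have := weighted_integralE q.
rewrite Lq0 (@integral_itv_bndoo _ _ _ _ true false); last first.
  exact: measurable_int ioo.
move=> int0.
have : (\int[mu]_(x in `]b, c[) `|(q.[x] * omega x)%:E| = 0)%E.
  rewrite -[RHS]int0; apply: eq_integral => x /[!inE] xbc.
  by rewrite gee0_abs// lee_fin mulr_ge0 ?q0// ltW// omega_gt0.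
move=> abs0.
have [N [mN N0 bcN]] :=
  (ae_eq_integral_abs mu (measurable_itv _) (measurable_int _ ioo)).1 abs0.
have sub : `]b, c[%classic `<=` N `|` [set x | root q x].
  move=> x xbc; have [qx|qx] := boolP (root q x); [by right|left].
  apply: bcN => /= /(_ xbc)[] /eqP; rewrite mulf_eq0 -[q.[x] == 0]/(root q x).
  by rewrite (negbTE qx)/= gt_eqF// omega_gt0.
have croot := finite_set_countable (finite_set_root qN0).
have mroot := countable_measurable (@measurable_set1 R) croot.
have root0 := countable_lebesgue_measure0 croot.
have U0 : mu (N `|` [set x | root q x]) = 0%E by exact: null_set_setU.
have mU : measurable (N `|` [set x | root q x]) by exact: measurableU.
have : mu `]b, c[%classic = 0%E :=
  @subset_measure0 _ _ _ mu _ _ (measurable_itv _) mU sub U0.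
rewrite lebesgue_measure_itv/= lte_fin bc -EFinB => /eqP.
by rewrite eqe subr_eq0 gt_eqF.
Qed.

Lemma weighted_integral_orthogonal n P q :
  orthogonal_poly b c omega n P -> (size q <= n)%N -> L (P * q) = 0.
Proof.
move=> [_ Porth] /Porth Pq0; apply: EFin_inj.
rewrite -weighted_integralE -[RHS]Pq0.
by apply: eq_integral => x _; rewrite hornerM.
Qed.

(* If P = (X - r) Q with r outside the interval, then P Q = (X - r) Q^2 has a
   constant sign there, although Q is orthogonal to P. *)
Lemma orthogonal_poly_root_in n P (r : R) :
  orthogonal_poly b c omega n P -> root P r -> b < r < c.
Proof.
move=> Porth; have [sP _] := Porth.
move=> /factor_theorem[Q PE].
have P0 : P != 0 by rewrite -size_poly_gt0 sP.
have Q0 : Q != 0 by apply: contraNneq P0 => Q0; rewrite PE Q0 mul0r.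
have sQ : size Q = n.
  by move: sP; rewrite PE size_Mmonic ?monicXsubC// size_XsubC addn2 => -[].
have PQ0 : P * Q != 0 by rewrite mulf_neq0.
have LPQ : L (P * Q) = 0.
  by apply: weighted_integral_orthogonal Porth _; rewrite sQ.
have PQE x : (P * Q).[x] = (x - r) * Q.[x] ^+ 2.
  by rewrite PE !hornerM hornerXsubC; ring.
apply/andP; split; rewrite ltNge; apply/negP => rle; move/eqP: PQ0; apply.
  apply: weighted_integral_eq0 LPQ => x; rewrite in_itv/= => /andP[bx xc].
  by rewrite PQE mulr_ge0 ?sqr_ge0//; lra.
apply/eqP; rewrite -oppr_eq0; apply/eqP; apply: weighted_integral_eq0.
  move=> x; rewrite in_itv/= => /andP[bx xc].
  by rewrite hornerN PQE -mulNr mulr_ge0 ?sqr_ge0//; lra.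
by rewrite -scaleN1r -/(L _) weighted_integralZ LPQ mulr0.
Qed.

(** The leading terms cancel in the difference [D], so its degree is below n; being a combination of
    [P] and [q], it is orthogonal to itself and hence zero. *)
Lemma orthogonal_poly_uniq n P q :
  orthogonal_poly b c omega n P -> orthogonal_poly b c omega n q ->
  lead_coef q *: P = lead_coef P *: q.
Proof.
move=> Porth qorth; have [sP _] := Porth; have [sq _] := qorth.
apply/eqP; rewrite -subr_eq0; set D := (X in X == 0).
have sD : (size D <= n)%N.
  apply/leq_sizeP => j; rewrite leq_eqVlt => /predU1P[<-|nj].
    by rewrite coefB !coefZ /lead_coef sP sq mulrC subrr.
  by rewrite coefB !coefZ !nth_default ?sP ?sq// !mulr0 subrr.
apply/eqP; have : D * D = 0; last by move/eqP; rewrite mulf_eq0 orbb => /eqP.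
apply: weighted_integral_eq0.
  by move=> x _; rewrite hornerM -expr2 sqr_ge0.
rewrite {1}/D mulrBl -!scalerAl -scaleN1r.
rewrite weighted_integralD !weighted_integralZ.
by rewrite !(weighted_integral_orthogonal _ sD)// !mulr0 addr0.
Qed.

Lemma size_lagrange_poly n (x : 'I_n -> R) j :
  (size (lagrange_poly x j) <= n)%N.
Proof.
rewrite /lagrange_poly; apply: leq_trans (size_poly_prod_leq _ _) _.
have : (\sum_(k < n | k != j) size ((x j - x k)^-1 *: ('X - (x k)%:P)) <=
    \sum_(k < n | k != j) 2)%N.
  apply: leq_sum => k _.
  by rewrite (leq_trans (size_scale_leq _ _))// size_XsubC.
(* With n - 1 factors of size at most 2, the product bound is 2 (n - 1) + 1 - (n - 1) = n. *)
rewrite leq_subLR sum_nat_const.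
have -> : #|(fun k => k != j)| = n.-1.
  by rewrite -[n in RHS]card_ord -(cardC1 j); apply: eq_card.
case: n x j => [x []//|n x j] /= SE.
by rewrite addnS ltnS addnn -muln2.
Qed.

Lemma lagrange_poly_node n (x : 'I_n -> R) j k : injective x ->
  (lagrange_poly x j).[x k] = (j == k)%:R.
Proof.
move=> xinj; rewrite /lagrange_poly horner_prod; have [<-|jk] := eqVneq j k.
  rewrite big1// => i ij; rewrite !hornerE mulVf// subr_eq0.
  by apply: contraNneq ij => /xinj ->.
by rewrite (bigD1 k) ?[k == j]eq_sym//= !hornerE subrr mulr0 mul0r.
Qed.

(** The difference of the two sides has n distinct roots, the nodes, but size at most n. *)
Lemma lagrange_interpolation n (x : 'I_n -> R) q : injective x ->
  (size q <= n)%N -> q = \sum_(j < n) q.[x j] *: lagrange_poly x j.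
Proof.
move=> xinj sq; apply/eqP; rewrite -subr_eq0; apply/eqP.
apply: (@roots_geq_poly_eq0 _ _ (codom x)).
- apply/allP => _ /codomP[k ->]; rewrite rootE hornerD hornerN horner_sum.
  rewrite (bigD1 k)//= big1 ?addr0 => [|i ik].
    by rewrite hornerZ lagrange_poly_node// eqxx mulr1 subrr.
  by rewrite hornerZ lagrange_poly_node// (negbTE ik) mulr0.
- exact/injectiveP.
- rewrite size_codom card_ord (leq_trans (size_polyD _ _))//.
  rewrite geq_max sq size_polyN.
  apply: (leq_trans (size_sum _ _ _)); apply/bigmax_leqP => i _.
  exact: leq_trans (size_scale_leq _ _) (size_lagrange_poly _ _).
Qed.

(** Divide [q] by the orthogonal polynomial [P]. The quotient has size at most n, so its product
    with [P] integrates to 0, and that product also vanishes at the nodes. The remainder is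
    integrated exactly by interpolation. *)
Lemma gauss_quadrature_exact n (x w : 'I_n -> R) q :
  gauss_quadrature b c omega x w -> (size q <= n + n)%N ->
  L q = \sum_(j < n) w j * q.[x j].
Proof.
move=> [xinj [P Porth Px] wE] sq; have [sP _] := Porth.
have P0 : P != 0 by rewrite -size_poly_gt0 sP.
have wL j : w j = L (lagrange_poly x j).
  by apply: EFin_inj; rewrite wE weighted_integralE.
rewrite [in LHS](divp_eq q P) weighted_integralD [_ * P]mulrC.
rewrite (weighted_integral_orthogonal Porth) ?add0r; last first.
  by rewrite size_divp// sP/= leq_subLR.
have sr : (size (q %% P)%R <= n)%N by have := ltn_modp q P; rewrite P0 sP ltnS.
rewrite (lagrange_interpolation xinj sr) weighted_integral_sum.
apply: eq_bigr => j _; rewrite weighted_integralZ -wL mulrC; congr (_ * _).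
by rewrite [in RHS](divp_eq q P) hornerD hornerM (eqP (Px j)) mulr0 add0r.
Qed.

Section symmetric_weight.
Hypothesis L_even : forall q, L (q \Po - 'X) = L q.

Let size_opp_comp q : size (q \Po - 'X) = size q.
Proof. by rewrite size_comp_poly2// size_polyN size_polyX. Qed.

Let horner_opp_comp q x : (q \Po - 'X).[x] = q.[- x].
Proof. by rewrite horner_comp hornerN hornerX. Qed.

Lemma orthogonal_poly_opp n P :
  orthogonal_poly b c omega n P -> orthogonal_poly b c omega n (P \Po - 'X).
Proof.
move=> Porth; have [sP _] := Porth; split; first by rewrite size_opp_comp.
move=> q sq.
transitivity (L ((P * (q \Po - 'X)) \Po - 'X))%:E.
  rewrite -weighted_integralE; apply: eq_integral => x _.
  by rewrite !horner_opp_comp hornerM horner_opp_comp opprK.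
by rewrite L_even (weighted_integral_orthogonal Porth)// size_opp_comp.
Qed.

(** By uniqueness [P] is proportional to its reflection, so its roots, which are the nodes, are
    symmetric about 0; [sg] is the induced permutation. *)
Lemma gauss_quadrature_opp n (x w : 'I_n -> R) :
  gauss_quadrature b c omega x w ->
  exists2 sg : 'I_n -> 'I_n, injective sg &
    forall j, x (sg j) = - x j /\ w (sg j) = w j.
Proof.
move=> xw; have [xinj [P Porth Px] wE] := xw; have [sP _] := Porth.
have P0 : P != 0 by rewrite -size_poly_gt0 sP.
have Pop := orthogonal_poly_opp Porth.
have PE := orthogonal_poly_uniq Porth Pop.
have xN j : exists k, x k = - x j.
  have rN : root P (- x j).
    have /(congr1 (horner^~ (x j))) := PE.
    rewrite !hornerZ (eqP (Px j)) mulr0 horner_opp_comp => /esym/eqP.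
    by rewrite mulf_eq0 lead_coef_eq0 (negbTE P0).
  (* Otherwise - x j would be a root of [P] besides the n nodes, one too many for degree n. *)
  apply: contrapT => nk.
  have : (size (- x j :: codom x) < size P)%N.
    apply: max_poly_roots => //=.
      by rewrite rN; apply/allP => _ /codomP[k ->].
    apply/andP; split; last exact/injectiveP.
    by apply/negP => /codomP[k kE]; apply: nk; exists k.
  by rewrite /= size_codom card_ord sP ltnn.
have [sg sgE] := choice xN.
have sginj : injective sg.
  by move=> i j ij; apply: xinj; apply: oppr_inj; rewrite -!sgE ij.
exists sg => // j; split => //; apply: EFin_inj; rewrite wE weighted_integralE.
(* Apply the rule to the reflected Lagrange polynomial of node [sg j]: at x i it takes the value at
   x (sg i), so only the weight of j survives. *)
congr EFin; rewrite -L_even (gauss_quadrature_exact xw); last first.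
  by rewrite size_opp_comp (leq_trans (size_lagrange_poly _ _))// leq_addr.
rewrite (bigD1 j)//= big1 ?addr0 => [|i ij].
  by rewrite horner_opp_comp -sgE lagrange_poly_node// eqxx mulr1.
rewrite horner_opp_comp -sgE lagrange_poly_node// (inj_eq sginj) eq_sym.
by rewrite (negbTE ij) mulr0.
Qed.

Lemma gauss_quadrature_odd n (x w : 'I_n -> R) (g : R -> R) :
  gauss_quadrature b c omega x w -> (forall r, g (- r) = - g r) ->
  \sum_(j < n) w j * g (x j) = 0.
Proof.
move=> /gauss_quadrature_opp[sg sginj sgE] godd.
suff : \sum_(j < n) w j * g (x j) = - \sum_(j < n) w j * g (x j) by lra.
rewrite {1}(reindex_inj sginj) -sumrN /=; apply: eq_bigr => j _.
by have [-> ->] := sgE j; rewrite godd mulrN.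
Qed.

End symmetric_weight.

End gauss.

Lemma poly_primitive (F : numFieldType) (p : {poly F}) :
  exists q : {poly F}, q^`() = p.
Proof.
(* For i = 0 the coefficient is a division by 0, which is 0 by convention: the primitive has no
   constant term. *)
exists (\poly_(i < (size p).+1) (p`_i.-1 / i%:R)).
apply/polyP => i; rewrite coef_deriv coef_poly ltnS.
have [ip|pi] := ltnP i (size p); last by rewrite mul0rn nth_default.
by rewrite -[LHS]mulr_natr divfK// pnatr_eq0.
Qed.

(** Bounds both polynomials handed to the Gauss rules: the powers of 1 - X^2 come from replacing
    sin(th)^2 or rho(z)^2. *)
Lemma size_Xn_mul_1mX2_leq (F : idomainType) (k m : nat) :
  (size ('X^k * (1 - 'X^2) ^+ m : {poly F})%R <= (k + m.*2).+1)%N.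
Proof.
apply: leq_trans (size_polyMleq _ _) _; rewrite size_polyXn addSn /=.
rewrite -addnS leq_add2l (leq_trans (size_poly_exp_leq _ _))// ltnS -muln2 mulnC.
rewrite leq_mul2l; apply/orP; right; rewrite -subn1 leq_subLR.
by rewrite (leq_trans (size_polyD _ _))// size_polyN size_polyXn size_poly1.
Qed.

(** * Trigonometric moments and the Gauss-Chebyshev rule *)

Section chebyshev.
Context {R : realType}.
Notation mu := (@lebesgue_measure R).
Implicit Types p q : {poly R}.

Definition trig_moment (i j : nat) : R :=
  \int[mu]_(th in `[0, 2 * pi]) (cos th ^+ i * sin th ^+ j).

(** With Q a primitive of [q], the integrand is the derivative of Q(g), which takes the same value
    at both ends of the period. *)
Lemma integral_horner_deriv_period (g g' : R -> R) q :
  continuous g -> continuous g' -> (forall x : R, is_derive x 1 g (g' x)) ->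
  g (2 * pi) = g 0 ->
  \int[mu]_(th in `[0, 2 * pi]) (q.[g th] * g' th) = 0.
Proof.
move=> cg cg' dg g2pi; have [Q QE] := poly_primitive q.
have dF (x : R) : is_derive x 1 (fun th => Q.[g th]) (q.[g x] * g' x).
  have dQ := is_derive_poly Q (g x); rewrite QE in dQ.
  exact: (is_derive1_comp dQ).
rewrite /Rintegral (@continuous_FTC2 _ _ (fun th => Q.[g th])).
- by rewrite g2pi subee.
- by have := @pi_gt0 R; lra.
- apply: continuous_subspaceT => x; apply: cvgM; last exact: cg'.
  exact: continuous_horner_comp.
- have cF (x : R) : {for x, continuous (fun th => Q.[g th])}.
    by apply/differentiable_continuous/derivable1_diffP; have [] := dF x.
  split; first by move=> x _; have [] := dF x.
    by apply: cvg_at_right_filter; exact: cF.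
  by apply: cvg_at_left_filter; exact: cF.
- by move=> x _; rewrite derive1E; have [_ ->] := dF x.
Qed.

(* An odd power of one function leaves a polynomial in the other one times its
   derivative. *)
Lemma trig_moment_odd i j : odd i || odd j -> trig_moment i j = 0.
Proof.
have oddE n : odd n -> n = n./2.*2.+1.
  by move=> on; rewrite -{1}(odd_double_half n) on.
have c2pi : cos (2 * pi) = cos 0 :> R by rewrite mulr_natl cos2pi cos0.
have s2pi : sin (2 * pi) = sin 0 :> R by rewrite mulr_natl sin2pi sin0.
case/orP => /oddE ->.
- rewrite -[RHS](@integral_horner_deriv_period (@sin R) (@cos R)
    ((1 - 'X^2) ^+ i./2 * 'X^j))//; last 2 first.
  + exact: continuous_sin.
  + exact: continuous_cos.
  apply: eq_Rintegral => th _; rewrite !hornerE -cos2sin2.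
  by rewrite exprS -mul2n exprM; ring.
- rewrite -[RHS](@integral_horner_deriv_period (@cos R) (fun x => - sin x)
    (- ('X^i * (1 - 'X^2) ^+ j./2)))//; last 2 first.
  + exact: continuous_cos.
  + by move=> x; apply: cvgN; exact: continuous_sin.
  apply: eq_Rintegral => th _; rewrite !hornerE -sin2cos2.
  by rewrite exprS -mul2n exprM; ring.
Qed.

Let omega (r : R) := (1 - r ^+ 2) `^ (- (1 / 2)).

Lemma chebyshev_weight_gt0 : {in `]-1, 1[, forall r : R, 0 < omega r}.
Proof. by move=> r; rewrite in_itv/= => /andP[r1 r2]; apply: powR_gt0; nra. Qed.

Lemma integrable_chebyshev_weight : mu.-integrable `[(-1 : R), 1] (EFin \o omega).
Proof.
have mw : measurable_fun `[(-1 : R), 1] omega.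
  apply: (@measurableT_comp _ _ _ _ _ _ (@powR R ^~ (- (1 / 2)))) => //.
  by apply: measurable_funB => //; exact: measurable_funX.
apply/integrableP; split; first exact/measurable_EFinP.
have p1 : {in `]-1, 1[, forall x : R, 0 <= (1 : {poly R}).[x]}.
  by move=> x _; rewrite hornerE.
have := ge0_integral_chebyshev p1.
under eq_integral do rewrite hornerE mul1r.
under [X in (X < _)%E]eq_integral do rewrite /= ger0_norm ?powR_ge0//.
by move=> ->; exact: ltry.
Qed.

(** Removes the sign condition from [ge0_integral_chebyshev]: with M a bound of |q| on [-1, 1], the
    formula holds for q + M and for 1, and linearity gives it for [q]. *)
Lemma weighted_integral_chebyshev q :
  weighted_integral (-1) 1 omega q =
  2^-1 * \int[mu]_(th in `[0, 2 * pi]) q.[cos th].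
Proof.
have n11 : -1 < 1 :> R by lra.
have iw := integrable_chebyshev_weight.
have pos p : {in `]-1, 1[, forall x : R, 0 <= p.[x]} ->
    weighted_integral (-1) 1 omega p =
    2^-1 * \int[mu]_(th in `[0, 2 * pi]) p.[cos th].
  move=> p0; apply: EFin_inj.
  by rewrite -weighted_integralE// ge0_integral_chebyshev.
have icos p : mu.-integrable `[0, 2 * pi] (EFin \o (fun th : R => p.[cos th])).
  apply: continuous_compact_integrable; first exact: segment_compact.
  apply: continuous_subspaceT.
  by apply: continuous_horner_comp; exact: continuous_cos.
have [M qM] := bounded_horner n11 q.
have := pos (q + M *: 1); rewrite weighted_integralD// weighted_integralZ//.
rewrite (pos 1); last by move=> x _; rewrite hornerE.
have -> : \int[mu]_(th in `[0, 2 * pi]) (q + M *: 1).[cos th] =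
    \int[mu]_(th in `[0, 2 * pi]) q.[cos th] +
    M * \int[mu]_(th in `[0, 2 * pi]) (1 : {poly R}).[cos th].
  rewrite -RintegralZl//.
  rewrite -RintegralD//.
    by apply: eq_Rintegral => th _; rewrite hornerD hornerZ.
  have := icos (M *: 1); congr (mu.-integrable _ _).
  by apply/funext => th /=; rewrite hornerZ.
have qM0 : {in `]-1, 1[, forall x : R, 0 <= (q + M *: 1).[x]}.
  move=> x /subset_itv_oo_cc /qM; rewrite ler_norml => /andP[qx _].
  by rewrite !hornerE; lra.
by move=> /(_ qM0); lra.
Qed.

(** Reflection changes only the sign of odd monomials, and these integrate to odd moments of cos,
    which are 0. This is the symmetry hypothesis needed for the Gauss-Chebyshev nodes. *)
Lemma weighted_integral_chebyshev_opp q :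
  weighted_integral (-1) 1 omega (q \Po - 'X) =
  weighted_integral (-1) 1 omega q.
Proof.
have n11 : -1 < 1 :> R by lra.
have iw := integrable_chebyshev_weight.
have compE p : weighted_integral (-1) 1 omega (q \Po p) =
    \sum_(i < size q) q`_i * weighted_integral (-1) 1 omega (p ^+ i).
  rewrite comp_polyE (weighted_integral_sum n11 iw).
  by apply: eq_bigr => i _; rewrite (weighted_integralZ n11 iw).
rewrite -[q in RHS]comp_polyXr !compE; apply: eq_bigr => i _; congr (_ * _).
rewrite exprNn -signr_odd; have [oi|] := boolP (odd i); last by rewrite mul1r.
rewrite expr1 mulN1r -['X^i in LHS]scale1r -scaleNr.
rewrite weighted_integralZ// weighted_integral_chebyshev.
suff -> : \int[mu]_(th in `[0, 2 * pi]) ('X^i).[cos th] = 0 by rewrite !mulr0.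
rewrite -[RHS](@trig_moment_odd i 0) ?oi//; apply: eq_Rintegral => th _.
by rewrite hornerXn mulr1.
Qed.

Lemma gauss_quadrature_trig_moment n (s ws : 'I_n -> R) i j :
  gauss_quadrature (-1) 1 omega s ws -> (i + j < n)%N ->
  \sum_(l < n) ws l * (s l ^+ i * Num.sqrt (1 - s l ^+ 2) ^+ j +
    (- s l) ^+ i * (- Num.sqrt (1 - s l ^+ 2)) ^+ j) = trig_moment i j.
Proof.
move=> sws ijn; have n11 : -1 < 1 :> R by lra.
have iw := integrable_chebyshev_weight.
(* For i odd the summand is an odd function of the node, whatever the parity of j; for i even and j
   odd the two antipodal terms cancel one by one. *)
have [oi|ei] := boolP (odd i).
  rewrite trig_moment_odd ?oi//.
  rewrite (gauss_quadrature_odd n11 iw chebyshev_weight_gt0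
    weighted_integral_chebyshev_opp
    (g := fun r => r ^+ i * Num.sqrt (1 - r ^+ 2) ^+ j +
                   (- r) ^+ i * (- Num.sqrt (1 - r ^+ 2)) ^+ j) sws)//.
  move=> r; rewrite sqrrN opprK ![(- r) ^+ _]exprNn -signr_odd oi expr1; ring.
have [oj|ej] := boolP (odd j).
  rewrite trig_moment_odd ?oj ?orbT// big1// => l _.
  rewrite [(- s l) ^+ _]exprNn [(- Num.sqrt _) ^+ _]exprNn.
  rewrite -[(-1) ^+ i]signr_odd -[(-1) ^+ j]signr_odd oj (negbTE ei).
  by rewrite expr0 expr1; ring.
have jE : j = (2 * j./2)%N by rewrite mul2n -[LHS]odd_double_half (negbTE ej).
pose q : {poly R} := 'X^i * (1 - 'X^2) ^+ j./2.
have qE x : q.[x] = x ^+ i * (1 - x ^+ 2) ^+ j./2 by rewrite /q !hornerE.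
have sq : (size q <= n + n)%N.
  rewrite (leq_trans (size_Xn_mul_1mX2_leq _ _ _))//.
  by rewrite -mul2n -jE (leq_trans ijn)// leq_addr.
(* For i and j even the antipodal terms coincide. The resulting factor 2 cancels the 1/2 of
   [weighted_integral_chebyshev]. *)
transitivity (2 * weighted_integral (-1) 1 omega q).
  rewrite (gauss_quadrature_exact _ _ sws sq)// mulr_sumr.
  apply: eq_bigr => l _.
  have [_ [P Porth Ps] _] := sws.
  have /andP[s1 s2] :=
    orthogonal_poly_root_in n11 iw chebyshev_weight_gt0 Porth (Ps l).
  rewrite [(- s l) ^+ _]exprNn [(- Num.sqrt _) ^+ _]exprNn.
  rewrite -[(-1) ^+ i]signr_odd -[(-1) ^+ j]signr_odd (negbTE ej) (negbTE ei).
  rewrite {1 2}jE exprM sqr_sqrtr; last nra.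
  by rewrite qE; ring.
rewrite weighted_integral_chebyshev mulrA mulfV// mul1r.
apply: eq_Rintegral => th _.
by rewrite [in RHS]jE exprM sin2cos2 qE.
Qed.

End chebyshev.

(** * Integration of weighted monomials over the cap *)

Section cap_integral.
Context {R : realType}.
Notation mu := (@lebesgue_measure R).
Notation T := (measurableTypeR R * measurableTypeR R * measurableTypeR R)%type.
Variables alpha a : R.
Hypothesis alpha_itv : -1 < alpha < 1.
Hypothesis a_gtN1 : -1 < a.

Let omega (r : R) := (r - alpha) `^ a.
Let alpha1 : alpha < 1. Proof. by case/andP: alpha_itv. Qed.
Let omega_int := integrable_powR_subl alpha1 a_gtN1.

Lemma cap_point (c d z : R) : c ^+ 2 + d ^+ 2 = 1 -> alpha < z < 1 ->
  cap alpha (rho z * c, rho z * d, z).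
Proof.
move=> cd1 az1; split => //=.
rewrite !exprMn -mulrDr cd1 mulr1 /rho sqr_sqrtr ?subrK//.
by case/andP: az1 => az z1; case/andP: alpha_itv => a1 _; nra.
Qed.

(** Archimedes' formula for integrands whose angular integral is a polynomial [P] in z, so that only
    a weighted integral in z remains. *)
Lemma ge0_integral_cap_weight (h : T -> R) (P : {poly R}) :
  measurable_fun setT h -> (forall p, cap alpha p -> 0 <= h p) ->
  (forall z, continuous (fun th => h (rho z * cos th, rho z * sin th, z))) ->
  (forall z, alpha < z < 1 ->
     \int[mu]_(th in `[0, 2 * pi]) h (rho z * cos th, rho z * sin th, z) =
     P.[z]) ->
  (\int[surface_measure]_(p in cap alpha) (h p * omega p.2)%:E =
   (weighted_integral alpha 1 omega P)%:E)%E.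
Proof.
move=> mh h0 ch hP.
have momega : measurable_fun setT omega.
  apply: (@measurableT_comp _ _ _ _ _ _ (@powR R ^~ a)) => //.
  exact: measurable_funB.
(* [ge0_integral_cap] requires nonnegativity everywhere, while [h] has it only on the cap; the
   absolute value repairs this without changing the integral. *)
pose g (p : T) := (`|h p| * omega p.2)%:E.
transitivity (\int[surface_measure]_(p in cap alpha) g p)%E.
  by apply: eq_integral => p /[!inE] cp; rewrite /g ger0_norm// h0.
rewrite ge0_integral_cap//; last 3 first.
- by case/andP: alpha_itv.
- apply/measurable_EFinP; apply: measurable_funM; first exact: measurableT_comp.
  by apply: measurableT_comp => //; exact: measurable_snd.
- by move=> p; rewrite lee_fin mulr_ge0// powR_ge0.
rewrite -weighted_integralE// (@integral_itv_bndoo _ _ _ _ true false); last first.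
  apply/measurable_EFinP/measurable_funM => //; last exact: measurable_funTS.
  apply: measurable_funTS; apply: continuous_measurable_fun.
  exact: continuous_horner.
apply: eq_integral => z /[!inE]/=; rewrite in_itv/= => az1.
rewrite -hP// /g/=.
pose hz (th : R) : R := h (rho z * cos th, rho z * sin th, z) * omega z.
have chz : continuous hz by move=> th; apply: cvgMl; exact: ch.
transitivity (\int[mu]_(th in `[0%R, (2 * pi)%R[) (hz th)%:E)%E.
  apply: eq_integral => th _; rewrite ger0_norm// h0//.
  by apply: cap_point => //; rewrite cos2Dsin2.
rewrite integral_itv_bndo_bndc; last first.
  apply/measurable_EFinP; apply: measurable_funTS.
  exact: continuous_measurable_fun.
have ihz (k : R -> R) : continuous k -> mu.-integrable `[0, 2 * pi] (EFin \o k).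
  move=> ck; apply: continuous_compact_integrable; first exact: segment_compact.
  exact: continuous_subspaceT.
rewrite -RintegralZr//; last exact: ihz.
by rewrite /Rintegral fineK//; apply: integrable_fin_num => //; exact: ihz.
Qed.

Definition cap_monomial (i j k : nat) (p : R * R * R) : R :=
  p.1.1 ^+ i * p.1.2 ^+ j * p.2 ^+ k.

Lemma measurable_cap_monomial i j k :
  measurable_fun setT (cap_monomial i j k : T -> R).
Proof.
apply: measurable_funM; first apply: measurable_funM.
- apply: measurable_funX; apply: (measurableT_comp (f := fst)).
    exact: measurable_fst.
  exact: measurable_fst.
- apply: measurable_funX; apply: (measurableT_comp (f := snd)).
    exact: measurable_snd.
  exact: measurable_fst.
- by apply: measurable_funX; exact: measurable_snd.
Qed.

(** On the unit sphere each coordinate is at most 1 in absolute value. The bound gives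
    integrability, and makes the monomial plus one nonnegative. *)
Lemma cap_monomial_le1 i j k p : cap alpha p -> `|cap_monomial i j k p| <= 1.
Proof.
have sq_le1 (x : R) n : x ^+ 2 <= 1 -> `|x ^+ n| <= 1.
  move=> x1; rewrite normrX exprn_ile1//.
  by rewrite -(@expr_le1 _ 2)// real_normK// num_real.
move=> [_ p1]; rewrite /cap_monomial !normrM.
have [[h1 h2] h3] := (sqr_ge0 p.1.1, sqr_ge0 p.1.2, sqr_ge0 p.2).
have [h4 h5 h6] :
    [/\ `|p.1.1 ^+ i| <= 1, `|p.1.2 ^+ j| <= 1 & `|p.2 ^+ k| <= 1].
  by split; apply: sq_le1; lra.
by apply: mulr_ile1 => //; exact: mulr_ile1.
Qed.

Lemma integral_cap_weight :
  (\int[surface_measure]_(p in cap alpha) (omega p.2)%:E =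
   (weighted_integral alpha 1 omega (2 * pi)%:P)%:E)%E.
Proof.
rewrite -(@ge0_integral_cap_weight (cst 1)).
- by apply: eq_integral => p _; rewrite mul1r.
- exact: measurable_cst.
- by move=> p _; exact: ler01.
- by move=> z th; exact: cvg_cst.
- move=> z _; rewrite Rintegral_cst//= mul1r lebesgue_measure_itv/= lte_fin.
  by rewrite hornerC mulr_gt0 ?pi_gt0//= subr0.
Qed.

Lemma integrable_cap_weight :
  surface_measure.-integrable (cap alpha : set T) (fun p : T => (omega p.2)%:E).
Proof.
apply/integrableP; split.
  apply/measurable_EFinP; apply: measurable_funTS.
  apply: (measurableT_comp (f := omega)); last exact: measurable_snd.
  apply: (@measurableT_comp _ _ _ _ _ _ (@powR R ^~ a)) => //.
  exact: measurable_funB.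
under eq_integral do rewrite /= ger0_norm ?powR_ge0//.
by rewrite integral_cap_weight ltry.
Qed.

Lemma integrable_cap_monomial i j k :
  surface_measure.-integrable (cap alpha : set T)
    (fun p : T => (cap_monomial i j k p * omega p.2)%:E).
Proof.
rewrite (_ : (fun p => _) =
  ((EFin \o cap_monomial i j k) \* (fun p : T => (omega p.2)%:E))%E); last first.
  by apply/funext => p /=; rewrite EFinM.
apply: integrableMr.
- exact: measurable_cap.
- by apply: measurable_funTS; exact: measurable_cap_monomial.
- exists 1; split; first exact: num_real.
  by move=> y y1 p cp; exact: le_trans (cap_monomial_le1 _ _ _ cp) (ltW y1).
- exact: integrable_cap_weight.
Qed.

(* Archimedes' formula is available for nonnegative integrands only: it is
   applied to the monomial plus one. *)
Lemma integral_cap_monomial i j k (q : {poly R}) :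
  (forall z, alpha < z < 1 ->
     trig_moment i j * (rho z ^+ (i + j) * z ^+ k) = trig_moment i j * q.[z]) ->
  (\int[surface_measure]_(p in cap alpha)
     (cap_monomial i j k p * omega p.2)%:E =
   (trig_moment i j * weighted_integral alpha 1 omega q)%:E)%E.
Proof.
move=> qE; set I := trig_moment i j.
pose h (p : T) := cap_monomial i j k p + 1.
have cX (g : R -> R) n : continuous g -> continuous (fun x => g x ^+ n).
  move=> cg x; apply: (@cvg_comp _ _ _ g (fun y => y ^+ n) _ (nbhs (g x))).
    exact: cg.
  exact: exprn_continuous.
have ctrig (z : R) : continuous
    (fun th => cap_monomial i j k (rho z * cos th, rho z * sin th, z)).
  move=> th; rewrite /cap_monomial/=; apply: cvgMl; apply: cvgM.
    apply: (cX (fun x => rho z * cos x)) => x; apply: cvgMr.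
    exact: continuous_cos.
  apply: (cX (fun x => rho z * sin x)) => x; apply: cvgMr.
  exact: continuous_sin.
have mh : measurable_fun setT h.
  by apply: measurable_funD => //; exact: measurable_cap_monomial.
have h0 p : cap alpha p -> 0 <= h p.
  by move=> /(cap_monomial_le1 i j k); rewrite ler_norml /h => /andP[]; lra.
have ch z : continuous (fun th => h (rho z * cos th, rho z * sin th, z)).
  by move=> th; apply: cvgD; [exact: ctrig | exact: cvg_cst].
have ic (g : R -> R) : continuous g -> mu.-integrable `[0, 2 * pi] (EFin \o g).
  move=> cg; apply: continuous_compact_integrable; first exact: segment_compact.
  exact: continuous_subspaceT.
have hI z : alpha < z < 1 ->
    \int[mu]_(th in `[0, 2 * pi]) h (rho z * cos th, rho z * sin th, z) =
    (I *: q + (2 * pi)%:P).[z].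
  move=> az1; rewrite RintegralD//; last 2 first.
  - by apply: ic; exact: ctrig.
  - by apply: ic; exact: cst_continuous.
  rewrite hornerD hornerC hornerZ -qE//; congr (_ + _).
    transitivity (\int[mu]_(th in `[0, 2 * pi])
        (rho z ^+ (i + j) * z ^+ k * (cos th ^+ i * sin th ^+ j))).
      apply: eq_Rintegral => th _.
      by rewrite /cap_monomial/= !exprMn exprD; ring.
    rewrite RintegralZl//; first by rewrite mulrC.
    apply: ic => th; apply: cvgM.
      by apply: (cX (@cos R)); exact: continuous_cos.
    by apply: (cX (@sin R)); exact: continuous_sin.
  rewrite Rintegral_cst//= mul1r lebesgue_measure_itv/= lte_fin.
  by rewrite mulr_gt0 ?pi_gt0//= subr0.
have := ge0_integral_cap_weight mh h0 ch hI.
rewrite weighted_integralD// weighted_integralZ// EFinD -integral_cap_weight.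
under eq_integral do rewrite mulrDl mul1r EFinD.
rewrite integralD//=; last 3 first.
- exact: measurable_cap.
- exact: integrable_cap_monomial.
- exact: integrable_cap_weight.
rewrite integral_cap_weight; set c := weighted_integral _ _ _ (2 * pi)%:P.
by move/(congr1 (fun u => u - c%:E)%E); rewrite !addeK.
Qed.

End cap_integral.

(** * Assembly: product indexing, exactness on monomials, linearity *)

Lemma node_index_inj m n :
  injective (fun u : 'I_m * 'I_n => node_index u.1 u.2).
Proof.
move=> [j l] [j' l'] /(congr1 val)/= jl.
have n0 : (0 < n)%N := leq_ltn_trans (leq0n l) (ltn_ord l).
have ll' : val l = val l'.
  have := congr1 (modn^~ n) jl.
  by rewrite /= ![(_ + _ * n)%N]addnC !modnMDl !modn_small.
have jj' : val j = val j'.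
  have := congr1 (divn^~ n) jl.
  by rewrite /= ![(_ + _ * n)%N]addnC !divnMDl// !divn_small// !addn0.
by congr pair; exact: val_inj.
Qed.

Lemma sum_node_index (V : nmodType) m n (F : 'I_(m * n) -> V) :
  \sum_k F k = \sum_(j < m) \sum_(l < n) F (node_index j l).
Proof.
rewrite pair_bigA /= (reindex (fun u : 'I_m * 'I_n => node_index u.1 u.2))//=.
apply: onW_bij; apply: inj_card_bij; first exact: node_index_inj.
by rewrite card_prod !card_ord.
Qed.

Lemma meval_cap_monomial (R : realType) (p : mpoly 3 R) (u v z : R) :
  meval (tnth [tuple u; v; z]) p =
  \sum_(m <- msupp p) mcoeff m p *
    cap_monomial (m ord0) (m (lift ord0 ord0)) (m ord_max) (u, v, z).
Proof.
rewrite mevalE. apply: eq_bigr => m _; congr (_ * _).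
rewrite 3!big_ord_recl big_ord0 mulr1 mulrA /cap_monomial /=.
congr (_ * _ ^+ m _); exact: val_inj.
Qed.

Theorem theorem2 (R : realType) (alpha a : R) (M1 M2 N : nat)
    (t wt : 'I_M1 -> R) (s ws : 'I_M2 -> R)
    (x y z w : 'I_(M1 * M2) -> R) (f : R * R * R -> R) :
  -1 < alpha < 1 -> -1 < a ->
  gauss_quadrature alpha 1 (fun r => (r - alpha) `^ a) t wt ->
  gauss_quadrature (-1) 1 (fun r => (1 - r ^+ 2) `^ (- (1 / 2))) s ws ->
  (forall (j : 'I_M1) (l : 'I_M2),
    [/\ x (node_index j l) = rho (t j) * s l,
        y (node_index j l) = rho (t j) * Num.sqrt (1 - s l ^+ 2),
        z (node_index j l) = t j
      & w (node_index j l) = wt j * ws l]) ->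
  1 / 2 * (N%:R + 1) <= M1%:R :> R ->
  (N + 1 <= M2)%N ->
  polynomial_on (cap alpha) N f ->
  (\int[surface_measure]_(p in cap alpha) (f p * (p.2 - alpha) `^ a)%:E =
    (\sum_(k < M1 * M2)
       w k * (f (x k, y k, z k) + f (- x k, - y k, z k)))%:E)%E.
Proof.
move=> alpha_itv a1 twt sws nodes NM1 NM2 [P degP fP].
have alpha1 : alpha < 1 by case/andP: alpha_itv.
have iomega := integrable_powR_subl alpha1 a1.
have omega_gt0 : {in `]alpha, 1[, forall r : R, 0 < (r - alpha) `^ a}.
  by move=> r; rewrite in_itv/= => /andP[ar r1]; rewrite powR_gt0 ?subr_gt0.
(* The bound in the form used by [gauss_quadrature_exact], where the size is the degree plus one. *)
have {}NM1 : (N.+1 <= M1 + M1)%N.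
  by rewrite -(ler_nat R) natrD -addn1 natrD; lra.
have t_itv j : alpha < t j < 1.
  have [_ [Q Qorth Qt] _] := twt.
  exact: (orthogonal_poly_root_in alpha1 iomega omega_gt0 Qorth (Qt j)).
have s_itv l : -1 < s l < 1.
  have [_ [Q Qorth Qs] _] := sws; have n11 : -1 < 1 :> R by lra.
  exact: (orthogonal_poly_root_in n11 integrable_chebyshev_weight
    (@chebyshev_weight_gt0 R) Qorth (Qs l)).
have s_circle l : s l ^+ 2 + Num.sqrt (1 - s l ^+ 2) ^+ 2 = 1.
  by rewrite sqr_sqrtr ?subrKC//; have /andP[] := s_itv l; nra.
have exact_monomial i j k : (i + j + k <= N)%N ->
  (\int[surface_measure]_(p in cap alpha)
     (cap_monomial i j k p * (p.2 - alpha) `^ a)%:E =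
   (\sum_(n < M1 * M2) w n * (cap_monomial i j k (x n, y n, z n) +
      cap_monomial i j k (- x n, - y n, z n)))%:E)%E.
  move=> ijkN.
  (* For i + j even, substituting rho(z)^2 = 1 - z^2 turns rho(z)^(i+j) z^k into [q], of degree at
     most i + j + k. *)
  pose q : {poly R} := 'X^k * (1 - 'X^2) ^+ (i + j)./2.
  have sq : (size q <= M1 + M1)%N.
    rewrite (leq_trans (size_Xn_mul_1mX2_leq _ _ _))// (leq_trans _ NM1)// ltnS.
    have := odd_double_half (i + j); lia.
  (* The moment stays on both sides: rho^(i+j) need not be polynomial when i or j is odd, but then
     the moment is 0. *)
  have qE r : alpha < r < 1 ->
      @trig_moment R i j * (rho r ^+ (i + j) * r ^+ k) =
      trig_moment i j * q.[r].
    move=> /andP[ar r1].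
    have [ij|ij] := boolP (odd i || odd j).
      by rewrite trig_moment_odd// !mul0r.
    have ijE : (i + j)%N = (2 * (i + j)./2)%N.
      rewrite mul2n -[LHS]odd_double_half oddD.
      by case: (odd i) (odd j) ij => [] [].
    rewrite {1}ijE exprM /rho sqr_sqrtr; last by case/andP: alpha_itv => ? _; nra.
    by rewrite mulrC [RHS]mulrC /q !hornerE [_ * r ^+ k]mulrC.
  rewrite (integral_cap_monomial alpha_itv a1 qE); congr EFin.
  rewrite (gauss_quadrature_exact alpha1 iomega twt sq) sum_node_index mulr_sumr.
  (* The node t m lies in ]alpha, 1[, so [qE] restores the power of rho there; the moment then
     becomes the discrete angular sum. *)
  apply: eq_bigr => m _; rewrite mulrCA -qE// mulrCA.
  rewrite -(gauss_quadrature_trig_moment sws); last first.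
    by rewrite (leq_trans _ NM2)// addn1 ltnS; lia.
  rewrite mulr_suml; apply: eq_bigr => l _; have [-> -> -> ->] := nodes m l.
  by rewrite /cap_monomial/= -!mulrN !exprMn exprD; ring.
(* [f] agrees with its polynomial only on the cap, so both antipodal quadrature points must be shown
   to lie there. *)
have node_cap j l :
    cap alpha (rho (t j) * s l, rho (t j) * Num.sqrt (1 - s l ^+ 2), t j).
  exact: (cap_point alpha_itv (s_circle l) (t_itv j)).
have node_cap_opp j l : cap alpha
    (- (rho (t j) * s l), - (rho (t j) * Num.sqrt (1 - s l ^+ 2)), t j).
  rewrite -[- (_ * s l)]mulrN -[- (_ * Num.sqrt _)]mulrN.
  apply: (cap_point alpha_itv _ (t_itv j)).
  by rewrite !sqrrN.
rewrite (_ : \sum_(n < M1 * M2) _ = \sum_(m <- msupp P) mcoeff m P *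
    \sum_(n < M1 * M2) w n *
      (cap_monomial (m ord0) (m (lift ord0 ord0)) (m ord_max) (x n, y n, z n) +
       cap_monomial (m ord0) (m (lift ord0 ord0)) (m ord_max)
         (- x n, - y n, z n))); last first.
  under [RHS]eq_bigr do rewrite mulr_sumr.
  rewrite exchange_big/= !sum_node_index.
  apply: eq_bigr => j _; apply: eq_bigr => l _.
  have [-> -> -> _] := nodes j l.
  rewrite !fP// !meval_cap_monomial -big_split mulr_sumr.
  by apply: eq_bigr => m _; rewrite /=; ring.
transitivity (\int[surface_measure]_(p in cap alpha) \sum_(m <- msupp P)
    ((mcoeff m P)%:E * (cap_monomial (m ord0) (m (lift ord0 ord0)) (m ord_max) p *
                       (p.2 - alpha) `^ a)%:E))%E.
  apply: eq_integral => -[[u v] r] /[!inE] cuvr.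
  rewrite fP// meval_cap_monomial mulr_suml -sumEFin.
  by apply: eq_bigr => m _; rewrite -mulrA EFinM.
have icap i j k := integrable_cap_monomial alpha_itv a1 i j k.
rewrite integral_sum; last 2 first.
- exact: measurable_cap.
- by move=> m; apply: integrableZl; [exact: measurable_cap | exact: icap].
rewrite -sumEFin big_seq [RHS]big_seq; apply: eq_bigr => m mP.
rewrite integralZl; [|exact: measurable_cap|exact: icap].
rewrite EFinM exact_monomial//.
(* [mmeasure] is the degree plus one, hence the strict inequality for every monomial in the
   support. *)
have : (mdeg m < N.+1)%N := leq_trans (mmeasure_mnm_lt _ mP) degP.
rewrite ltnS mdegE.
rewrite 3!big_ord_recl big_ord0 addn0 addnA; congr (_ + m _ <= _)%N.
exact: val_inj.
Qed.
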